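(* Let $p\in[0,1]$ and let $(\mathbf H_t)_{t\in\mathbb N}$ be a sequence of stabilizer matrices, $\mathbf H_t$ having $n_t$ columns and defining a stabilizer code of rate $R_t$. Suppose that $R_t$ converges to $R$ and that the decoding error probability $P_{err}$ of the codes over the quantum erasure channel of erasure probability $p$ tends to $0$ as $t\to\infty$ (that is, $R$ is an achievable rate for the sequence). Then $$R\le 1-2p-D(p),$$ where $D$ is the rank difference function of the sequence, $D(p)=\limsup_t \Delta_t(p)$ with $$\Delta_t(p)=\frac{\mathbb E_p\left[\operatorname{rank}\mathbf H_{t,\bar{\mathcal E}}-\operatorname{rank}\mathbf H_{t,\mathcal E}\right]}{n_t}.$$
   Context: Pauli group: $\mathcal P_n$ is the group of $n$-fold tensor products of $I,X,Y,Z$ taken modulo phases $\{\pm1,\pm i\}$; it is identified with $\mathbb F_2^{2n}$ by $X_i\mapsto(e_i|0)$, $Z_i\mapsto(0|e_i)$, $Y_i\mapsto (e_i|e_i)$, so that multiplication becomes addition. Two elements commute or anti-commute (as operators); $E,E'$ anti-commute iff the number of positions $j$ where $E_j,E'_j$ are distinct and both different from $I$ is odd. A stabilizer matrix $\mathbf H$ is an $r\times n$ matrix with entries in $\{I,X,Y,Z\}$ whose rows (elements of $\mathcal P_n$) pairwise commute. It generates the stabilizer group $S\subset\mathcal P_n$. $\operatorname{rank}\mathbf H$ is the $\mathbb F_2$-dimension of the span of the rows. The associated stabilizer code has length $n$, encodes $k=n-\operatorname{rank}\mathbf H$ qubits, and has rate $R=k/n$. The syndrome of $E\in\mathcal P_n$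 is $\sigma(E)\in\mathbb F_2^r$, whose $i$-th coordinate is $0$ if $E$ commutes with the $i$-th row and $1$ otherwise. For $v\in\mathbb F_2^n$ (also viewed as a subset of $\{1,\dots,n\}$), $\bar v$ is its complement, and $\mathbf H_v$ is the submatrix of $\mathbf H$ formed by the columns $i$ with $v_i=1$; its rank is the $\mathbb F_2$-dimension of the span of its rows in $\mathbb F_2^{2|v|}$. Quantum erasure channel of probability $p$: the erasure $\mathcal E\in\mathbb F_2^n$ is random with i.i.d. Bernoulli($p$) coordinates ($\mathbb E_p$ denotes the corresponding expectation); given $\mathcal E$, the error $E$ is uniform among Pauli operators $E\in\mathcal P_n$ with $E_i=I$ whenever $\mathcal E_i=0$ (written $E\subset\mathcal E$). The decoder sees $(\mathcal E,\sigma(E))$ and must determine the coset $E\cdot S\in \mathcal P_n/S$. $P_{err}$ is the probability that the best possible estimate $\hat X$ of $X=E\cdot S$, as a function of $(\mathcal E,\sigma(E))$, differs from $X$. *)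

(* Defs.v *)
From HB Require Import structures.
From mathcomp Require Import all_boot all_order all_algebra all_fingroup.
From mathcomp Require Import all_classical all_reals all_analysis.

Set Implicit Arguments.
Unset Strict Implicit.
Unset Printing Implicit Defensive.

Import Order.TTheory GRing.Theory Num.Theory.
Import numFieldNormedType.Exports.

Local Open Scope ring_scope.

(* Paulis modulo phases, encoded by their (X-part, Z-part):
   I = (0, 0), X = (1, 0), Z = (0, 1), Y = (1, 1). *)
Notation pauli := ('F_2 * 'F_2)%type.

Definition pauli_op (n : nat) : Type := 'rV[pauli]_n.

HB.instance Definition _ (n : nat) := GRing.Zmodule.on (pauli_op n).
HB.instance Definition _ (n : nat) := Finite.on (pauli_op n).
HB.instance Definition _ (n : nat) := [finGroupMixin of pauli_op n for +%R].

Definition anticommute (n : nat) (E F : pauli_op n) : bool :=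
  odd #|[set j : 'I_n | [&& E 0 j != F 0 j, E 0 j != 0 & F 0 j != 0]]|.

Definition stabilizer_matrix (r n : nat) (H : 'M[pauli]_(r, n)) : Prop :=
  forall i j : 'I_r, ~~ anticommute (row i H) (row j H).

Definition binary_mx (r n : nat) (H : 'M[pauli]_(r, n)) : 'M['F_2]_(r, n + n) :=
  row_mx (map_mx fst H) (map_mx snd H).

Definition pauli_rank (r n : nat) (H : 'M[pauli]_(r, n)) : nat :=
  \rank (binary_mx H).

Definition col_submx (r n : nat) (H : 'M[pauli]_(r, n)) (v : {set 'I_n}) :
    'M[pauli]_(r, #|v|) :=
  colsub (fun j : 'I_#|v| => enum_val j) H.

Definition stab_group (r n : nat) (H : 'M[pauli]_(r, n)) :
    {group pauli_op n} :=
  <<[set (row i H : pauli_op n) | i : 'I_r]>>%G.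

Definition syndrome (r n : nat) (H : 'M[pauli]_(r, n)) (E : pauli_op n) :
    'rV['F_2]_r :=
  \row_i (anticommute (row i H) E)%:R.

Definition errors_in (n : nat) (v : {set 'I_n}) : {set pauli_op n} :=
  [set E : pauli_op n | [forall j : 'I_n, (j \notin v) ==> (E 0 j == 0)]].

(* The element E . S of the quotient; pauli_op n being abelian, [coset S] is
   the projection on all of pauli_op n. *)
Definition stab_coset (r n : nat) (H : 'M[pauli]_(r, n)) (E : pauli_op n) :
    coset_of (stab_group H) :=
  coset (stab_group H) E.

Definition estimator (r n : nat) (H : 'M[pauli]_(r, n)) : Type :=
  {set 'I_n} -> 'rV['F_2]_r -> coset_of (stab_group H).

Section Probability.
Variable R : realType.

Definition erasure_prob (p : R) (n : nat) (v : {set 'I_n}) : R :=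
  \prod_(i < n) (if i \in v then p else 1 - p).

Definition erasure_expectation (p : R) (n : nat) (f : {set 'I_n} -> R) : R :=
  \sum_(v : {set 'I_n}) erasure_prob p v * f v.

Definition estimator_error (p : R) (r n : nat) (H : 'M[pauli]_(r, n))
    (g : estimator H) : R :=
  erasure_expectation p (fun v : {set 'I_n} =>
    #|[set E in errors_in v | g v (syndrome H E) != stab_coset H E]|%:R
      / #|errors_in v|%:R).

(* Only finitely many values occur, so this infimum is a minimum. *)
Definition decoding_error (p : R) (r n : nat) (H : 'M[pauli]_(r, n)) : R :=
  inf (range (fun g : estimator H => estimator_error p g)).

Definition code_rate (r n : nat) (H : 'M[pauli]_(r, n)) : R :=
  (n%:R - (pauli_rank H)%:R) / n%:R.

Definition rank_diff (p : R) (r n : nat) (H : 'M[pauli]_(r, n)) : R :=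
  erasure_expectation p (fun v : {set 'I_n} =>
    (pauli_rank (col_submx H (~: v)))%:R - (pauli_rank (col_submx H v))%:R)
  / n%:R.

Definition rank_diff_limsup (r n : nat -> nat)
    (H : forall t : nat, 'M[pauli]_(r t, n t)) (p : R) : R :=
  limn_sup (fun t : nat => rank_diff p (H t)).

End Probability.

(* Main.v *)
(* Fix an erasure v. Errors supported in v have at most 2^(rank H_v) syndromes,
   and those with a given syndrome that an estimator decodes correctly lie in
   one coset of S, hence in a translate of S /\ V_v, where V_v denotes the
   errors supported in v; this intersection has at most
   2^(rank H - rank H_{~v}) elements. As |V_v| = 4^|v|, the
   estimator fails with probability at least 1 - 2^(-d), where
   d(v) = 2|v| - rank H - rank H_v + rank H_{~v}. Since d is an integer with
   d <= 2n, this is at least d / (4n). Averaging over v gives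
   Delta_t(p) <= 1 - 2p - R_t + 4 P_err. *)
Require Import Defs.
From mathcomp Require Import all_boot all_order all_algebra all_fingroup.
From mathcomp Require Import mxabelem ring lra.
From mathcomp Require Import all_classical all_reals all_analysis.
Import Order.TTheory GRing.Theory Num.Theory.
Import numFieldNormedType.Exports.
Local Open Scope classical_set_scope.
Local Open Scope ring_scope.

(** * Syndromes as linear algebra over the two-element field *)

Lemma anticommute_sum {n : nat} (E F : pauli_op n) :
  (anticommute E F)%:R =
  \sum_j ((E 0 j).1 * (F 0 j).2 + (E 0 j).2 * (F 0 j).1) :> 'F_2.
Proof.
(* On one qubit, anticommutation is the symplectic form; all sixteen pairs are checked. *)
have pauliE (a b : pauli) : ([&& a != b, a != 0 & b != 0] : nat)%:R =
    a.1 * b.2 + a.2 * b.1 :> 'F_2.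
  by move: a b; do 2!case=> [[[|[|//]] ?] [[|[|//]] ?]]; apply/val_inj.
under eq_bigr do rewrite -pauliE.
rewrite -natr_sum /anticommute -modn2 Fp_nat_mod //.
by rewrite -sum1dep_card [in LHS]big_mkcond.
Qed.

(** Swapping the X- and Z-parts of [E] turns the symplectic form into a dot product, which places
    every syndrome in the column space of [binary_mx H]. *)
Lemma syndrome_mul {r n : nat} (H : 'M[pauli]_(r, n)) (E : pauli_op n) :
  syndrome H E =
  row_mx (map_mx snd (E : 'rV_n)) (map_mx fst (E : 'rV_n)) *m (binary_mx H)^T.
Proof.
apply/rowP => i; rewrite tr_row_mx mul_row_col !mxE anticommute_sum.
rewrite -big_split /=; apply: eq_bigr => j _; rewrite !mxE /=.
by congr (_ + _); rewrite mulrC.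
Qed.

Lemma syndrome_col_submx {r n : nat} (H : 'M[pauli]_(r, n)) (v : {set 'I_n})
    (E : pauli_op n) :
  E \in errors_in v -> syndrome H E = syndrome (col_submx H v) (col_submx E v).
Proof.
rewrite inE => /forallP Ev; apply/rowP => i; rewrite !mxE !anticommute_sum.
rewrite (bigID (mem v)) /= [X in _ + X]big1 ?addr0 => [|j /(implyP (Ev j))/eqP-> ].
  by rewrite big_enum_val; apply: eq_bigr => j _; rewrite !mxE.
by rewrite !mulr0 addr0.
Qed.

Lemma card_rowg_F2 {m n : nat} (A : 'M['F_2]_(m, n)) :
  #|rowg A| = (2 ^ \rank A)%N.
Proof. by rewrite card_rowg card_Fp. Qed.

Lemma card_syndromes {r n : nat} (H : 'M[pauli]_(r, n)) (v : {set 'I_n}) :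
  (#|syndrome H @: errors_in v| <=
     2 ^ pauli_rank (col_submx H v))%N.
Proof.
rewrite /pauli_rank -mxrank_tr -card_rowg_F2.
apply: subset_leq_card; apply/fintype.subsetP => s /imsetP[E Ev ->].
by rewrite mem_rowg (syndrome_col_submx _ _ _ Ev) syndrome_mul submxMl.
Qed.

(** * Stabilizer elements supported in an erasure *)

Lemma binary_mx_inj {r n : nat} : injective (@binary_mx r n).
Proof.
move=> A B /eq_row_mx[/matrixP A1 /matrixP A2]; apply/matrixP => i j.
by move: (A1 i j) (A2 i j); rewrite !mxE; case: (A i j) (B i j) => ? ? [? ?] /= -> ->.
Qed.

Lemma binary_mxD {r n : nat} (A B : 'M[pauli]_(r, n)) :
  binary_mx (A + B) = binary_mx A + binary_mx B.
Proof.
by rewrite /binary_mx add_row_mx; congr row_mx; apply/matrixP => i j; rewrite !mxE.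
Qed.

(** The operators with binary vector in the row space form a group containing the generators. *)
Lemma stab_group_sub {r n : nat} (H : 'M[pauli]_(r, n)) (E : pauli_op n) :
  E \in stab_group H -> (binary_mx E <= binary_mx H)%MS.
Proof.
have grp : group_set [set F : pauli_op n | (binary_mx F <= binary_mx H)%MS].
  apply/group_setP; split=> [|F G]; rewrite !inE.
    suff -> : binary_mx (1%g : pauli_op n) = 0 by apply: sub0mx.
    by apply/matrixP => i j; rewrite !mxE; case: splitP => k _; rewrite !mxE.
  by move=> FH GH; rewrite binary_mxD addmx_sub.
suff /fintype.subsetP SH : stab_group H \subset Group grp.
  by move=> /SH; rewrite inE.
rewrite gen_subG; apply/fintype.subsetP => _ /imsetP[i _ ->]; rewrite inE.
suff -> : binary_mx (row i H) = row i (binary_mx H) by apply: row_sub.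
by rewrite row_row_mx /binary_mx !map_row.
Qed.

(* Multiplication by [restr_mx v] keeps the columns of [v] in both halves. *)
Definition restr_mx {n : nat} (v : {set 'I_n}) : 'M['F_2]_(n + n, #|v| + #|v|) :=
  let Q := colsub (fun j : 'I_#|v| => enum_val j) 1%:M in block_mx Q 0 0 Q.

Lemma binary_mx_col_submx {r n : nat} (H : 'M[pauli]_(r, n)) (v : {set 'I_n}) :
  binary_mx (col_submx H v) = binary_mx H *m restr_mx v.
Proof.
rewrite mul_row_block !mulmx0 addr0 add0r !mulmx_colsub !mulmx1.
by congr row_mx; apply/matrixP => i j; rewrite !mxE.
Qed.

Lemma card_stab_errors {r n : nat} (H : 'M[pauli]_(r, n)) (v : {set 'I_n}) :
  (#|(stab_group H : {set pauli_op n}) :&: errors_in v| *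
     2 ^ pauli_rank (col_submx H (~: v)) <= 2 ^ pauli_rank H)%N.
Proof.
rewrite /pauli_rank binary_mx_col_submx.
(* Rank-nullity for restriction to the complement of [v]: stabilizer elements supported in [v] lie
   in its kernel on the row space. *)
rewrite -(mxrank_mul_ker (binary_mx H) (restr_mx (~: v))) addnC expnD.
rewrite leq_mul2r; apply/orP; right.
rewrite -card_rowg_F2.
rewrite -(card_imset _ (@binary_mx_inj 1 n)).
apply: subset_leq_card; apply/fintype.subsetP => _ /imsetP[E ES ->].
move: ES; rewrite finset.inE => /andP[/stab_group_sub ES]; rewrite inE => /forallP Ev.
rewrite mem_rowg sub_capmx ES /=; apply/sub_kermxP.
rewrite -binary_mx_col_submx; apply/matrixP => i j; rewrite !mxE.
by case: splitP => k _; rewrite !mxE ord1;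
  have := Ev (enum_val k); rewrite -finset.in_setC enum_valP => /eqP ->.
Qed.

(** * Counting correctly decoded errors *)

Lemma card_errors_in {n : nat} (v : {set 'I_n}) :
  #|errors_in v| = (2 ^ (2 * #|v|))%N.
Proof.
have -> : errors_in v =
    (fun f : {ffun _} => \row_j f j : pauli_op n) @: pffun_on (0 : pauli) v predT.
  apply/setP => E; rewrite inE; apply/forallP/imsetP => [Ev|[f fv ->] j].
    exists [ffun j => E 0 j]; last by apply/rowP => j; rewrite mxE ffunE.
    apply/pffun_onP; split=> [|? _ //]; apply/supportP => j jv.
    by rewrite ffunE; apply/eqP; have := Ev j; rewrite jv.
  by apply/implyP => jv; case/pffun_onP: fv => /supportP fv _; rewrite mxE fv.
rewrite card_imset ?card_pffun_on; last first.
  by move=> f g /rowP fg; apply/ffunP => j; have := fg j; rewrite !mxE.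
by rewrite card_prod card_Fp // expnM.
Qed.

Lemma stab_cosetP {r n : nat} (H : 'M[pauli]_(r, n)) (E F : pauli_op n) :
  stab_coset H E = stab_coset H F -> E - F \in stab_group H.
Proof.
(* [coset] is trivial outside the normaliser, so equal cosets are informative only inside it;
   conjugation being trivial, it is the whole group. *)
have normS (G : pauli_op n) : G \in 'N(stab_group H)%g.
  apply/normP/finset.setP => x; rewrite mem_conjg.
  suff -> : (x ^ G^-1)%g = x by [].
  by rewrite /conjg /mulg /invg /= opprK addrCA subrr addr0.
by move=> /(rcoset_kercosetP (normS E) (normS F)); rewrite mem_rcoset.
Qed.

(* Two errors of [errors_in v] with the same syndrome that are both guessed
   correctly differ by an element of the stabilizer supported in [v]. *)
Lemma card_correct_errors {r n : nat} (H : 'M[pauli]_(r, n)) (v : {set 'I_n})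
    (g : 'rV['F_2]_r -> coset_of (stab_group H)) :
  (#|[set E in errors_in v | g (syndrome H E) == stab_coset H E]| *
     2 ^ pauli_rank (col_submx H (~: v)) <=
   2 ^ (pauli_rank (col_submx H v) + pauli_rank H))%N.
Proof.
set C := [set E in _ | _]; rewrite expnD.
set K := (stab_group H : {set pauli_op n}) :&: errors_in v.
suff CK : (#|C| <= 2 ^ pauli_rank (col_submx H v) * #|K|)%N.
  apply: leq_trans (leq_mul CK (leqnn _)) _.
  by rewrite -mulnA leq_mul2l card_stab_errors orbT.
have CV : C \subset errors_in v by apply/fintype.subsetP => E /[!inE] /andP[].
rewrite -sum1_card (partition_big_imset (syndrome H)) /=.
apply: (@leq_trans (\sum_(s in syndrome H @: C) #|K|)); last first.
  rewrite sum_nat_const leq_mul2r (leq_trans _ (card_syndromes H v)) ?orbT //.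
  by rewrite subset_leq_card // imsetS.
apply: leq_sum => _ /imsetP[F CF ->]; rewrite sum1dep_card.
(* The correctly decoded errors with the syndrome of [F] lie in the translate of [K] by [F]. *)
rewrite -(card_imset K (@addIr _ (F : pauli_op n))).
apply: subset_leq_card; apply/fintype.subsetP => E; rewrite finset.inE.
case/andP => CE /eqP EF; apply/imsetP; exists (E - F); last by rewrite subrK.
move: CE CF; rewrite !inE => /andP[/forallP Ev /eqP gE] /andP[/forallP Fv /eqP gF].
rewrite stab_cosetP -?gE -?gF ?EF //=; apply/forallP => j; apply/implyP => jv.
have := Ev j; have := Fv j; rewrite jv /= => /eqP Fj /eqP Ej.
by rewrite !mxE Fj Ej subrr.
Qed.


(** * Expectation over random erasures *)

Section Expectation.
Context {R : realType} {p : R} (p01 : 0 <= p <= 1) {n : nat}.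
Implicit Types f g : {set 'I_n} -> R.

Lemma erasure_prob_ge0 (v : {set 'I_n}) : 0 <= erasure_prob p v.
Proof. by case/andP: p01 => p0 p1; apply: prodr_ge0 => i _; case: ifP => _; lra. Qed.

Lemma ler_erasure_expectation f g :
  (forall v, f v <= g v) -> erasure_expectation p f <= erasure_expectation p g.
Proof. by move=> fg; apply: ler_sum => v _; rewrite ler_wpM2l ?erasure_prob_ge0. Qed.

Lemma erasure_expectationD f g :
  erasure_expectation p (fun v => f v + g v) =
  erasure_expectation p f + erasure_expectation p g.
Proof. by rewrite -big_split; apply: eq_bigr => v _; rewrite mulrDr. Qed.

Lemma erasure_expectationZ (c : R) f :
  erasure_expectation p (fun v => c * f v) = c * erasure_expectation p f.
Proof. by rewrite mulr_sumr; apply: eq_bigr => v _; rewrite mulrCA. Qed.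

Lemma erasure_expectation_cst (c : R) :
  erasure_expectation p (fun _ : {set 'I_n} => c) = c.
Proof.
rewrite /erasure_expectation -mulr_suml -[RHS]mul1r; congr (_ * c).
(* Expanding this product over subsets gives the total mass of the erasures. *)
transitivity (\prod_(i < n) (p + (1 - p))); last by rewrite big1 // => i _; ring.
by rewrite bigA_distr; apply: eq_bigr.
Qed.

Lemma erasure_expectation_card :
  erasure_expectation p (fun v : {set 'I_n} => #|v|%:R) = n%:R * p.
Proof.
rewrite /erasure_expectation.
under eq_bigr => v _ do rewrite -sum1_card natr_sum mulr_sumr big_mkcond /=.
rewrite exchange_big /= -[X in X%:R * p]card_ord mulr_natl -sumr_const.
apply: eq_bigr => i _.
(* The erasures containing [i] are selected by giving [i] weight 0 off [v]. *)
transitivity (\prod_(j < n) (p + (if j == i then 0 else 1 - p))).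
  rewrite bigA_distr; apply: eq_bigr => v _; rewrite mulr1.
  case: ifPn => iv.
    by apply: eq_bigr => j _; case: ifPn => // jv; case: eqP => // ji;
       rewrite ji iv in jv.
  by rewrite (bigD1 i) //= (negPf iv) eqxx mul0r.
rewrite (bigD1 i) //= eqxx addr0 big1 ?mulr1 // => j /negPf ->; ring.
Qed.
End Expectation.

(** * Lower bound on the decoding error *)

Lemma pauli_rank_col_submx_le {r n : nat} (H : 'M[pauli]_(r, n)) (v : {set 'I_n}) :
  (pauli_rank (col_submx H v) <= pauli_rank H)%N.
Proof. by rewrite /pauli_rank binary_mx_col_submx mxrankM_maxl. Qed.

Lemma pauli_rank_le {r n : nat} (H : 'M[pauli]_(r, n)) : (pauli_rank H <= 2 * n)%N.
Proof. by rewrite mul2n -addnn rank_leq_col. Qed.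

(* For [d >= 1] at most half of the errors are guessed correctly, and
   [d <= 2 n]. *)
Lemma wrong_fraction_ge {R : realType} {r n : nat} (H : 'M[pauli]_(r, n))
    (v : {set 'I_n}) (g : 'rV['F_2]_r -> coset_of (stab_group H)) :
  let d : R := 2 * #|v|%:R - (pauli_rank H)%:R +
    ((pauli_rank (col_submx H (~: v)))%:R - (pauli_rank (col_submx H v))%:R) in
  (n > 0)%N ->
  d / (4 * n%:R) <=
    #|[set E in errors_in v | g (syndrome H E) != stab_coset H E]|%:R
      / #|errors_in v|%:R.
Proof.
move=> d n0; have := card_correct_errors H v g.
have bh := pauli_rank_col_submx_le H (~: v).
set W := #|[set E in _ | _ != _]|; set C := #|[set E in _ | _ == _]|.
have WC : (C + W = #|errors_in v|)%N.
  rewrite -(cardsID [set E | g (syndrome H E) == stab_coset H E] (errors_in v)).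
  by congr (_ + _)%N; apply: eq_card => E; rewrite !inE // andbC.
rewrite card_errors_in in WC *.
move: bh @d; set a := pauli_rank (col_submx H v); set b := pauli_rank _.
set h := pauli_rank H => bh d CB.
have vn : (#|v| <= n)%N by rewrite -[leqRHS]card_ord max_card.
have nR : 0 < n%:R :> R by rewrite ltr0n.
(* If [d <= 0] the bound is trivial; otherwise integrality gives [d >= 1]. *)
have [dle|dgt] := leqP (2 * #|v| + b) (a + h).
  apply: (@le_trans _ _ 0); last by rewrite divr_ge0.
  rewrite pmulr_lle0 ?invr_gt0 ?mulr_gt0 //.
  by move: dle; rewrite -(ler_nat R) natrD natrM natrD /d => ?; lra.
have CT : (2 * C <= 2 ^ (2 * #|v|))%N.
  rewrite -(leq_pmul2r (expn_gt0 2 b)) -mulnA -expnD.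
  apply: leq_trans (leq_mul (leqnn 2) CB) _.
  by rewrite -expnS leq_exp2l.
apply: (@le_trans _ _ (1 / 2)).
  rewrite ler_pdivrMr ?mulr_gt0 // /d.
  move: bh vn; rewrite -!(ler_nat R) => bh vn.
  by have : 0 <= a%:R :> R by []; lra.
rewrite ler_pdivlMr ?ltr0n ?expn_gt0 // -WC.
by move: CT; rewrite -WC -(ler_nat R) natrM natrD => ?; lra.
Qed.

Lemma rank_diff_le {R : realType} {p : R} (p01 : 0 <= p <= 1) {r n : nat}
    (H : 'M[pauli]_(r, n)) :
  (0 < n)%N ->
  rank_diff p H <= 1 - 2 * p - code_rate R H + 4 * decoding_error p H.
Proof.
move=> n0; have nR : 0 < n%:R :> R by rewrite ltr0n.
set D := rank_diff p H.
(* The numerator is the mean of [d], since an erasure has mean size [n * p]. *)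
suff : (2 * (n%:R * p) - (pauli_rank H)%:R + D * n%:R) / (4 * n%:R)
       <= decoding_error p H.
  rewrite ler_pdivrMr ?mulr_gt0 // => le_err.
  have rateE : code_rate R H * n%:R = n%:R - (pauli_rank H)%:R.
    by rewrite /code_rate divfK ?gt_eqF.
  by rewrite -(ler_pM2r nR); clearbody D; lra.
apply: lb_le_inf.
  (* A constant estimator shows that the infimum is over a nonempty set. *)
  by exists (estimator_error p (fun=> fun=> 1%g : coset_of (stab_group H)));
     exists (fun=> fun=> 1%g : coset_of (stab_group H)).
move=> _ [g _ <-].
apply: le_trans (ler_erasure_expectation p01 _ _
  (fun v => wrong_fraction_ge H v (g v) n0)).
under [leRHS]eq_bigr do rewrite [_ / (4 * _)]mulrC.
rewrite -/(erasure_expectation _ _) erasure_expectationZ mulrC.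
rewrite ler_pM2l ?invr_gt0 ?mulr_gt0 // 2!erasure_expectationD.
rewrite erasure_expectationZ erasure_expectation_card erasure_expectation_cst.
by rewrite /D /rank_diff divfK ?gt_eqF.
Qed.

(** * Passage to the limit *)

Lemma limn_sup_le {R : realType} (u w : R^nat) (l : R) :
  bounded_fun u -> (forall k, u k <= w k) -> w k @[k --> \oo] --> l ->
  limn_sup u <= l.
Proof.
move=> bu uw wl; rewrite limn_supE //; apply/ler_addgt0Pr => e e0.
have [N _ wN] : \forall k \near \oo, w k <= l + e.
  by apply: (cvgr_le l) => //; rewrite ltrDl.
apply: (@le_trans _ _ (sups u N)).
  by apply: ge_inf; [exact: bounded_fun_has_lbound_sups | exists N].
apply: ge_sup; first by exists (u N); exists N => /=.
by move=> _ [k /= Nk <-]; apply: le_trans (uw k) (wN k Nk).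
Qed.

(** Supplies the boundedness required by [limn_sup_le]: both ranks lie between 0 and [2 * n], the
    width of the binary matrix. *)
Lemma norm_rank_diff_le {R : realType} {p : R} (p01 : 0 <= p <= 1) {r n : nat}
    (H : 'M[pauli]_(r, n)) : (0 < n)%N -> `|rank_diff p H| <= 2.
Proof.
move=> n0; have nR : 0 < n%:R :> R by rewrite ltr0n.
have rk v : (pauli_rank (col_submx H v))%:R <= 2 * n%:R :> R.
  rewrite -natrM ler_nat.
  exact: leq_trans (pauli_rank_col_submx_le H v) (pauli_rank_le H).
have rk0 v : 0 <= (pauli_rank (col_submx H v))%:R :> R by [].
rewrite ler_norml /rank_diff ler_pdivrMr // ler_pdivlMr //; apply/andP; split.
  rewrite -[leLHS](@erasure_expectation_cst R p n).
  by apply: ler_erasure_expectation => // v; have := rk v; have := rk0 (~: v); lra.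
rewrite -[leRHS](@erasure_expectation_cst R p n).
by apply: ler_erasure_expectation => // v; have := rk0 v; have := rk (~: v); lra.
Qed.

Theorem theorem3p5 (R : realType) (p : R) (r n : nat -> nat)
    (H : forall t : nat, 'M[pauli]_(r t, n t)) (rate : R)
    (p01 : 0 <= p <= 1)
    (n_gt0 : forall t : nat, (0 < n t)%N)
    (Hstab : forall t : nat, stabilizer_matrix (H t))
    (Hrate : code_rate R (H t) @[t --> \oo] --> rate)
    (Herr : decoding_error p (H t) @[t --> \oo] --> (0 : R)) :
  rate <= 1 - 2 * p - rank_diff_limsup H p.
Proof.
suff : rank_diff_limsup H p <= 1 - 2 * p - rate + 4 * 0 by lra.
apply: (@limn_sup_le _ _
  (fun t => 1 - 2 * p - code_rate R (H t) + 4 * decoding_error p (H t))).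
- exists 2; split=> // M M2 t _; apply: le_trans (ltW M2).
  exact: norm_rank_diff_le.
- by move=> t; apply: rank_diff_le.
- by apply: cvgD; [apply: cvgB => //; exact: cvg_cst | apply: cvgMr].
Qed.
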